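(* Let $V\subset\mathbb{R}^N$. The reservoir system $\dot{x}(t)=F(x(t),\omega\phi^t(m))$ admits a uniform $V$-generalised synchronisation $f_{(\omega,\mathcal{V},F)}\in C^0(M,\mathbb{R}^N)$ if and only if the reservoir system is uniformly $V$-asymptotically stable with respect to $\{\omega\phi^t(m)\}_{m\in M}$. Furthermore, the uniform $V$-generalised synchronisation $f_{(\omega,\mathcal{V},F)}$ solves the quasilinear PDE $$\mathcal{L}_{\mathcal{V}}f_{(\omega,\mathcal{V},F)}=F(f_{(\omega,\mathcal{V},F)},\omega).$$
   Context: Setting. $\mathcal{V}$ is a smooth vector field on a smooth manifold $M$ with associated evolution operators $\{\phi^t\in\mathrm{Diff}^1(M)\mid t\in\mathbb{R}\}$ that form a group under composition, so that $\phi^{t_1+t_2}=\phi^{t_1}\phi^{t_2}$. The observation function $\omega\in C^0(M,\mathbb{R}^d)$ is continuous, and $F\in C^1(\mathbb{R}^N\times\mathbb{R}^d,\mathbb{R}^N)$ is Lipschitz continuous. Juxtaposition denotes composition, e.g. $\omega\phi^t(m)=\omega(\phi^t(m))$ and $f\phi^t(m)=f(\phi^t(m))$. The (continuous time) reservoir system is the ODE $\dot{x}(t)=F(x(t),\omega\phi^t(m))$, for $m\in M$. For $r\in\mathbb{R}^N$ and $m\in M$, $x^r_m(t)$ denotes its solution originating from the initial point $r$, i.e. $x^r_m(0)=r$. Definitions, for $V\subset\mathbb{R}^N$: - The reservoir system is uniformly $V$-asymptotically stable with respect to $\{\omega\phi^t(m)\}_{m\in M}$ if there exists a positive valued function $\psi:\mathbb{R}\to\mathbb{R}^+$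 converging to $0$ (as $t\to\infty$) such that for all $m\in M$ and all initial points $x_0,y_0\in V$, the solutions $x_m(t)$ and $y_m(t)$ originating from $x_0,y_0$ satisfy $\|x_m(t)-y_m(t)\|\le\psi(t)$ for all $t\ge0$. - The reservoir system admits a uniform $V$-generalised synchronisation $f_{(\omega,\mathcal{V},F)}\in C^0(M,V)$ if there exists a positive function $\psi:\mathbb{R}\to\mathbb{R}^+$ converging to $0$ (as $t\to\infty$) such that for any initial $r\in V$ and any $m\in M$ the solution $x^r_m(t)$ satisfies $\|f_{(\omega,\mathcal{V},F)}\phi^t(m)-x^r_m(t)\|\le\psi(t)$ for all $t\ge0$. - The Lie derivative of a map $u:M\to\mathbb{R}^N$ is $\mathcal{L}_{\mathcal{V}}u(m)=\frac{d}{dt}u\phi^t(m)\big|_{t=0}$, when the derivative on the right hand side exists.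
   Formalization: That stability implies a synchronisation is proved for V forward invariant (solutions starting in V stay in V for t ≥ 0); without this it fails, e.g. M a point, F=1, V={0}. The PDE is claimed for V nonempty; the synchronisation takes values in R^N. *)

(* Defs.v *)
From HB Require Import structures.
From mathcomp Require Import all_boot all_order all_algebra.
From mathcomp Require Import all_classical all_reals all_analysis.
Export numFieldNormedType.Exports.

Set Implicit Arguments.
Unset Strict Implicit.
Unset Printing Implicit Defensive.

Import Order.TTheory GRing.Theory Num.Theory.
Local Open Scope classical_set_scope.
Local Open Scope ring_scope.

(* U is meant to be open, so that continuity and differentiability at the
   points of U only depend on the values of f on U. *)
Fixpoint Ck_on (R : realType) (E G : normedModType R) (k : nat)
    (U : set E) (f : E -> G) : Prop :=
  if k is j.+1 then
    (forall x, U x -> differentiable f x) /\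
    (forall v, Ck_on j U (fun x => 'd f x v))
  else forall x, U x -> {for x, continuous f}.

Definition smooth_on (R : realType) (E G : normedModType R)
    (U : set E) (f : E -> G) : Prop := forall k, Ck_on k U f.

(* chart_map and chart_inv are total functions whose values outside chart_dom
   and its image are irrelevant. *)
Record chart (R : realType) (M : topologicalType) (q : nat) := Chart {
  chart_dom : set M ;
  chart_map :> M -> 'rV[R]_q ;
  chart_inv : 'rV[R]_q -> M ;
  chart_dom_open : open chart_dom ;
  chart_img_open : open (chart_map @` chart_dom) ;
  chart_mapK : forall m, chart_dom m -> chart_inv (chart_map m) = m ;
  chart_map_continuous :
    forall m, chart_dom m -> {for m, continuous chart_map} ;
  chart_inv_continuous :
    forall y, (chart_map @` chart_dom) y -> {for y, continuous chart_inv}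
}.

Record smooth_manifold (R : realType) (M : topologicalType) (q : nat)
    (atlas : set (chart R M q)) : Prop := SmoothManifold {
  manifold_hausdorff : hausdorff_space M ;
  manifold_second_countable : @second_countable M ;
  atlas_cover : forall m, exists2 c, atlas c & chart_dom c m ;
  atlas_smooth : forall c e, atlas c -> atlas e ->
    smooth_on (c @` (chart_dom c `&` chart_dom e)) (e \o chart_inv c)
}.

(* X c m is the coordinate vector of the tangent vector at m in the chart c. *)
Record smooth_vector_field (R : realType) (M : topologicalType) (q : nat)
    (atlas : set (chart R M q)) (X : chart R M q -> M -> 'rV[R]_q) : Prop :=
  SmoothVectorField {
  vector_field_smooth : forall c, atlas c ->
    smooth_on (c @` chart_dom c) (X c \o chart_inv c) ;
  vector_field_change : forall c e m, atlas c -> atlas e ->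
    chart_dom c m -> chart_dom e m ->
    X e m = 'd (e \o chart_inv c) (c m) (X c m)
}.

Definition C1_map (R : realType) (M : topologicalType) (q : nat)
    (atlas : set (chart R M q)) (g : M -> M) : Prop :=
  continuous g /\
  forall c e, atlas c -> atlas e ->
    Ck_on 1 (c @` (chart_dom c `&` g @^-1` chart_dom e))
      (e \o g \o chart_inv c).

Definition C1_diffeo (R : realType) (M : topologicalType) (q : nat)
    (atlas : set (chart R M q)) (g : M -> M) : Prop :=
  exists h : M -> M,
    [/\ cancel g h, cancel h g, C1_map atlas g & C1_map atlas h].

Record evolution_operators (R : realType) (M : topologicalType) (q : nat)
    (atlas : set (chart R M q)) (X : chart R M q -> M -> 'rV[R]_q)
    (phi : R -> M -> M) : Prop := EvolutionOperators {
  evolution0 : phi 0 = id ;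
  evolutionD : forall t1 t2, phi (t1 + t2) = phi t1 \o phi t2 ;
  evolution_diffeo : forall t, C1_diffeo atlas (phi t) ;
  evolution_continuous : forall m, continuous (phi^~ m) ;
  evolution_derive : forall c m t, atlas c -> chart_dom c (phi t m) ->
    is_derive t 1 (fun s => c (phi s m)) (X c (phi t m))
}.

Definition lie_derivable (R : realType) (M : topologicalType)
    (G : normedModType R) (phi : R -> M -> M) (u : M -> G) (m : M) : Prop :=
  derivable (fun t : R => u (phi t m)) 0 1.

Definition lie_derivative (R : realType) (M : topologicalType)
    (G : normedModType R) (phi : R -> M -> M) (u : M -> G) (m : M) : G :=
  'D_1 (fun t : R => u (phi t m)) 0.

Section Reservoir.
Context {R : realType} {M : topologicalType} {d N : nat}.
Variables (phi : R -> M -> M) (omega : M -> 'rV[R]_d).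
Variable F : 'rV[R]_N * 'rV[R]_d -> 'rV[R]_N.

Definition reservoir_solution (m : M) (r : 'rV[R]_N) (x : R -> 'rV[R]_N) :
    Prop :=
  x 0 = r /\ forall t : R, is_derive t 1 x (F (x t, omega (phi t m))).

Definition decay_bound (psi : R -> R) : Prop :=
  (forall t, 0 < psi t) /\ psi t @[t --> +oo] --> 0.

(* The norm on 'rV is the maximum norm; as psi is only asked to exist, the
   next two notions do not depend on the choice of the norm. *)
Definition uniformly_asymptotically_stable (V : set 'rV[R]_N) : Prop :=
  exists2 psi : R -> R, decay_bound psi &
    forall m x0 y0 x y, V x0 -> V y0 ->
      reservoir_solution m x0 x -> reservoir_solution m y0 y ->
      forall t, 0 <= t -> `|x t - y t| <= psi t.

Definition uniform_generalised_synchronisation (V : set 'rV[R]_N)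
    (f : M -> 'rV[R]_N) : Prop :=
  continuous f /\
  exists2 psi : R -> R, decay_bound psi &
    forall m r x, V r -> reservoir_solution m r x ->
      forall t, 0 <= t -> `|f (phi t m) - x t| <= psi t.

Definition forward_invariant (V : set 'rV[R]_N) : Prop :=
  forall m r x, V r -> reservoir_solution m r x ->
    forall t, 0 <= t -> V (x t).

End Reservoir.

(* Main.v *)
(* Uniform asymptotic stability makes the solution that starts in V at time -T
   forget its initial point as T grows: at time 0 it converges, uniformly in
   the phase point m, and the limit is the synchronisation f m. Each
   approximation is continuous in m by Gronwall's inequality, hence so is f.
   Conversely, two solutions that both shadow f stay close to each other.
   Along an orbit, a synchronisation is a locally uniform limit of solutions
   of the reservoir system, hence a solution itself; its derivative at time 0
   is the Lie derivative.

   Continuity in m needs joint continuity of (t, m) |-> phi t m, while the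
   evolution operators are only assumed separately continuous. A Baire category
   argument gives one time s1 of joint continuity, and the group law
   phi s = phi (s - s1) \o phi s1 moves it to every other time. *)

Require Import Defs.
From HB Require Import structures.
From mathcomp Require Import all_boot all_order all_algebra.
From mathcomp Require Import all_classical all_reals all_analysis.
From mathcomp Require Import ring lra.
Set Implicit Arguments.
Unset Strict Implicit.
Unset Printing Implicit Defensive.
Import Order.TTheory GRing.Theory Num.Theory.
Local Open Scope classical_set_scope.
Local Open Scope ring_scope.

(** * Differentiation and primitives of vector-valued functions *)

Lemma ler_derive_ge0 (R : realType) (f f' : R -> R) (a b : R) : a <= b ->
  (forall s, a <= s <= b -> is_derive s 1 f (f' s)) ->
  (forall s, a <= s <= b -> 0 <= f' s) -> f a <= f b.
Proof.
move=> ab df f'0.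
have cf : {within `[a, b], continuous f}.
  apply: derivable_within_continuous => s; rewrite in_itv /= => sab.
  by have [] := df s sab.
have dfo s : s \in `]a, b[%R -> is_derive s 1 f (f' s).
  by rewrite in_itv /= => /andP[/ltW as_ /ltW sb]; apply: df; rewrite as_.
have [c] := MVT_segment ab dfo cf.
rewrite in_itv /= => cab fE.
by rewrite -subr_ge0 fE mulr_ge0 ?f'0 ?subr_ge0.
Qed.

Section row_vectors.
Context {R : realType} {N : nat}.
Implicit Types v : 'rV[R]_N.

Lemma ler_norm_coord v i : `|v ord0 i| <= `|v|.
Proof.
by rewrite [leRHS]/Num.Def.normr/= mx_normrE; apply: (le_bigmax _ _ (ord0, i)).
Qed.

Lemma row_norm_le v c : 0 <= c -> (forall i, `|v ord0 i| <= c) -> `|v| <= c.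
Proof.
move=> c0 vc; rewrite [leLHS]/Num.Def.normr/= mx_normrE.
by apply: bigmax_le => // -[i j] _ /=; rewrite ord1.
Qed.

Lemma is_derive_rowP (x : R -> 'rV[R]_N) (t : R) v :
  is_derive t 1 x v <->
  forall i, is_derive t 1 (fun s => x s ord0 i) (v ord0 i).
Proof.
split=> [[dx <-] i|dx].
  apply: DeriveDef; first exact: (derivable_mxP _ _ _).1.
  by rewrite derive_mx// mxE.
have dx1 : derivable x t 1.
  by apply/derivable_mxP => i j; rewrite ord1; have [] := dx j.
apply: DeriveDef => //; rewrite derive_mx//; apply/rowP => j.
by rewrite mxE; apply: derive_val.
Qed.

Lemma is_derive_continuous (x : R -> 'rV[R]_N) (x' : R -> 'rV[R]_N) :
  (forall t : R, is_derive t 1 x (x' t)) -> continuous x.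
Proof.
move=> dx t; apply/differentiable_continuous/derivable1_diffP.
by have [] := dx t.
Qed.

Lemma is_derive_rev (x : R -> 'rV[R]_N) v (t : R) :
  is_derive (- t) 1 x v -> is_derive t 1 (fun s => x (- s)) (- v).
Proof.
move=> /is_derive_rowP dx; apply/is_derive_rowP => i; rewrite mxE -mulrN1.
exact: (is_derive1_comp (g := -%R) (dx i) (is_deriveNid t 1)).
Qed.

Lemma is_derive_translate (x : R -> 'rV[R]_N) v (s t : R) :
  is_derive (t + s) 1 x v -> is_derive t 1 (fun u => x (u + s)) v.
Proof.
move=> /is_derive_rowP dx; apply/is_derive_rowP => i; rewrite -[v _ _]mulr1.
exact: (is_derive1_comp (g := shift s) (dx i) (is_derive_shift t 1 s)).
Qed.

(** The norm of ['rV] is the maximum norm, so this mean value inequality splits into coordinates,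
    where [p + w_i] and [p - w_i] both have nonnegative derivative. *)
Lemma derive_norm_le_pos (w w' : R -> 'rV[R]_N) (p p' : R -> R) (T : R) :
  (forall t : R, is_derive t 1 w (w' t)) -> (forall t : R, is_derive t 1 p (p' t)) ->
  (forall t : R, 0 <= t <= T -> `|w' t| <= p' t) -> `|w 0| <= p 0 ->
  forall t : R, 0 <= t <= T -> `|w t| <= p t.
Proof.
move=> dw dp w'p' wp0 t /andP[t0 tT].
have p'0 (s : R) : 0 <= s <= t -> 0 <= p' s.
  by move=> /andP[s0 st]; apply: le_trans (w'p' _ _); rewrite ?s0 ?(le_trans st).
have ptp0 : p 0 <= p t by apply: (ler_derive_ge0 t0 (f' := p')).
have pt : 0 <= p t by apply: le_trans ptp0; apply: le_trans wp0.
apply: row_norm_le => // i; rewrite ler_norml.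
have dwi (s : R) : is_derive s 1 (fun s => w s ord0 i) (w' s ord0 i).
  by have /is_derive_rowP := dw s; apply.
have wi0 : `|w 0 ord0 i| <= p 0 := le_trans (ler_norm_coord _ _) wp0.
have w'i s : 0 <= s <= t -> `|w' s ord0 i| <= p' s.
  move=> /andP[s0 st]; apply: le_trans (ler_norm_coord _ _) (w'p' _ _).
  by rewrite s0 (le_trans st).
move: wi0; rewrite ler_norml => /andP[l0 u0].
apply/andP; split.
- have : p 0 + w 0 ord0 i <= p t + w t ord0 i.
    apply: (@ler_derive_ge0 _ (fun s => p s + w s ord0 i)
      (fun s => p' s + w' s ord0 i) _ _ t0).
    by move=> s /w'i; rewrite ler_norml => /andP[]; lra.
  by lra.
- have : p 0 - w 0 ord0 i <= p t - w t ord0 i.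
    apply: (@ler_derive_ge0 _ (fun s => p s - w s ord0 i)
      (fun s => p' s - w' s ord0 i) _ _ t0).
    by move=> s /w'i; rewrite ler_norml => /andP[]; lra.
  by lra.
Qed.

(** Negative times reduce to positive ones by reversing time in [w]; solutions live on the whole
    line. *)
Lemma derive_norm_le (w w' : R -> 'rV[R]_N) (p p' : R -> R) (T : R) :
  (forall t : R, is_derive t 1 w (w' t)) -> (forall t : R, is_derive t 1 p (p' t)) ->
  (forall t : R, `|t| <= T -> `|w' t| <= p' `|t|) -> `|w 0| <= p 0 ->
  forall t : R, `|t| <= T -> `|w t| <= p `|t|.
Proof.
move=> dw dp w'p' wp0 t tT.
have [t0|t0] := leP 0 t.
  rewrite (ger0_norm t0) in tT *.
  apply: (derive_norm_le_pos (T := T) dw dp); rewrite ?t0//.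
  by move=> s /andP[s0 sT]; have := w'p' s; rewrite ger0_norm//; apply.
rewrite ltr0_norm// in tT *; rewrite -[in leLHS](opprK t).
apply: (derive_norm_le_pos (T := T) (w := fun s => w (- s)) (w' := fun s => - w' (- s)) _ dp).
- by move=> s; apply: is_derive_rev.
- move=> s /andP[s0 sT]; rewrite normrN.
  by have := w'p' (- s); rewrite normrN ger0_norm//; apply.
- by rewrite oppr0.
- by rewrite tT oppr_ge0 ltW.
Qed.

End row_vectors.

Lemma is_derive0_eq (R : realType) (f : R -> R) (a b : R) : a <= b ->
  (forall s, a <= s <= b -> is_derive s 1 f 0) -> f a = f b.
Proof.
move=> ab df; apply/eqP; rewrite eq_le; apply/andP; split.
  exact: (ler_derive_ge0 (f' := cst 0)).
rewrite -lerN2; apply: (ler_derive_ge0 (f := fun s => - f s) (f' := cst 0) ab) => // s.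
by move=> /df d; rewrite /cst -oppr0; exact: is_deriveN.
Qed.

(** The fundamental theorem of calculus gives a primitive on each bounded interval; primitives
    vanishing at 0 agree where both are defined, so they glue together. *)
Lemma continuous_primitive (R : realType) (g : R -> R) : continuous g ->
  exists2 G : R -> R, G 0 = 0 & forall x : R, is_derive x 1 G (g x).
Proof.
move=> cg.
have loc (a : R) : exists2 H : R -> R, H 0 = 0 &
    forall x : R, `|x| < a -> is_derive x 1 H (g x).
  pose mu := @lebesgue_measure R.
  pose H x := (\int[mu]_(t in `[- a, x]) g t)%R.
  exists (fun x => H x - H 0) => [|x]; first by rewrite subrr.
  rewrite ltr_norml => /andP[ax xa].
  have ig : mu.-integrable `[- a, a] (EFin \o g).
    apply: continuous_compact_integrable; first exact: segment_compact.
    exact: continuous_subspaceT.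
  have [dH HE] := continuous_FTC1_closed xa ig ax (cg x).
  have dH' : is_derive x 1 H (g x).
    by apply: DeriveDef; [exact: dH | rewrite -derive1E; exact: HE].
  by rewrite -[g x]subr0; exact: is_deriveB.
pose H a := sval (cid2 (loc a)).
have H0 a : H a 0 = 0 by rewrite /H; case: cid2.
have dH a (x : R) : `|x| < a -> is_derive x 1 (H a) (g x).
  by rewrite /H; case: cid2 => /= K _; apply.
have uniq a b (x : R) : `|x| < a -> `|x| < b -> H a x = H b x.
  move=> xa xb; apply/eqP; rewrite -subr_eq0; apply/eqP.
  pose D s := H a s - H b s.
  have dD (s : R) : `|s| <= `|x| -> is_derive s 1 D 0.
    move=> sx; rewrite -(subrr (g s)).
    have ? := dH a s (le_lt_trans sx xa); have ? := dH b s (le_lt_trans sx xb).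
    exact: is_deriveB.
  have D0 : D 0 = 0 by rewrite /D !H0 subrr.
  rewrite -[LHS]/(D x) -D0; have [x0|x0] := leP 0 x.
    apply/esym/(is_derive0_eq x0) => s /andP[s0 sx]; apply: dD.
    by rewrite !ger0_norm.
  apply: (is_derive0_eq (ltW x0)) => s /andP[xs s0]; apply: dD.
  by rewrite ler0_norm// ltr0_norm// lerN2.
(* The index [|x| + 1] moves with the point; near [x] the fixed index [|x| + 2] gives the same
   values, and that function is the one differentiated. *)
exists (fun x => H (`|x| + 1) x) => // x.
apply: (near_eq_is_derive (f := H (`|x| + 2))).
  have /cvgrPdist_lt/(_ 1 ltr01) : s @[s --> x] --> x by exact: cvg_id.
  apply: filterS => s; rewrite distrC => sx; apply: uniq; rewrite ?ltrDl//.
  rewrite -(subrK x s); apply: le_lt_trans (ler_normD _ _) _; lra.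
by apply: dH; rewrite ltrDl.
Qed.

Section vector_calculus.
Context {R : realType} {N : nat}.

Lemma continuous_primitive_row (g : R -> 'rV[R]_N) : continuous g ->
  exists2 G : R -> 'rV[R]_N, G 0 = 0 & forall x : R, is_derive x 1 G (g x).
Proof.
move=> cg.
have cgi i : continuous (fun s => g s ord0 i).
  move=> s; apply: (continuous_comp (f := g) (g := fun v : 'rV[R]_N => v ord0 i)).
    exact: cg.
  exact: coord_continuous.
have /choice[G GP] i : exists G : R -> R, G 0 = 0 /\
    forall x : R, is_derive x 1 G (g x ord0 i).
  by have [G ? ?] := continuous_primitive (@cgi i); exists G.
exists (fun s => \row_i G i s) => [|x].
  by apply/rowP => i; rewrite !mxE (GP i).1.
apply/is_derive_rowP => i; rewrite (_ : (fun s => _) = G i); first exact: (GP i).2.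
by apply/funext => s; rewrite mxE.
Qed.

Lemma le_eps_eq0 (W : normedModType R) (v : W) (c : R) :
  (forall e, 0 < e -> `|v| <= c * e) -> v = 0.
Proof.
move=> vc; apply/eqP; rewrite -normr_le0; apply/ler_addgt0Pr => e e0; rewrite add0r.
have c1 : 0 < `|c| + 1 by rewrite ltr_wpDl.
apply: le_trans (vc _ (divr_gt0 e0 c1)) _.
rewrite mulrA ler_pdivrMr// mulrC ler_wpM2l ?(ltW e0)//.
by rewrite (le_trans (ler_norm c))// lerDl.
Qed.

(* The primitive of g turns uniform closeness of the derivatives into uniform
   closeness of the functions themselves. *)
Lemma is_derive_locally_uniform_limit (z g : R -> 'rV[R]_N) : continuous g ->
  (forall T e : R, 0 < e -> exists y h : R -> 'rV[R]_N,
    (forall t : R, is_derive t 1 y (h t)) /\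
    forall t : R, `|t| <= T -> `|y t - z t| <= e /\ `|h t - g t| <= e) ->
  forall t : R, is_derive t 1 z (g t).
Proof.
move=> cg approx; have [G G0 dG] := continuous_primitive_row cg.
suff zE : z = fun t => z 0 + G t.
  move=> t; rewrite zE -[g t]add0r; exact: is_deriveD.
apply/funext => t; apply/eqP; rewrite -subr_eq0; apply/eqP.
(* The [2] pays for the gaps between [y] and [z] at times [t] and [0], and [|t|] for the derivative
   gap accumulated in between. *)
apply: (@le_eps_eq0 _ _ (2 + `|t|)) => e e0.
have [y [h [dy yh]]] := approx `|t| e e0.
have dw (s : R) : is_derive s 1 (fun s => y s - y 0 - G s) (h s - 0 - g s).
  exact: is_deriveB.
have dp (s : R) : is_derive s 1 (fun s => e * s) e.
  by rewrite -[X in is_derive _ _ _ X]mulr1; exact: is_deriveZ.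
have wt : `|y t - y 0 - G t| <= e * `|t|.
  apply: (derive_norm_le (T := `|t|) dw dp) => //.
    by move=> s /yh[_]; rewrite subr0.
  by rewrite G0 !subrr normr0 mulr0.
have [yzt _] := yh t (lexx _).
have [yz0 _] := yh 0 (eq_ind_r (fun u => u <= _) (normr_ge0 t) (normr0 _)).
rewrite (_ : z t - _ = - (y t - z t) + (y 0 - z 0) + (y t - y 0 - G t)); last first.
  by apply/rowP => i; rewrite !mxE; ring.
have -> : (2 + `|t|) * e = e + e + e * `|t| by ring.
apply: le_trans (ler_normD _ _) (lerD _ wt).
by apply: le_trans (ler_normD _ _) _; rewrite normrN lerD.
Qed.

Lemma cauchy_rate_cvg (u : nat -> 'rV[R]_N) (b : nat -> R) :
  (forall n k, `|u n - u (n + k)%N| <= b n) -> b @ \oo --> 0 ->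
  cvgn u /\ forall n, `|u n - limn u| <= b n.
Proof.
move=> ub b0.
have cu : cvgn u.
  apply/cauchy_cvgP/cauchy_exP => e e0.
  have [n _ bn] : \forall n \near \oo, `|b n| < e.
    by move/cvgrPdist_lt : b0 => /(_ e e0); apply: filterS => n; rewrite sub0r normrN.
  exists (u n); exists n => // m /= nm.
  rewrite -ball_normE /= -(subnKC nm).
  apply: le_lt_trans (ub _ _) _; by apply: le_lt_trans (ler_norm _) (bn n _) => /=.
split=> // n.
apply/ler_addgt0Pr => e e0.
have [m _ um] : \forall m \near \oo, `|u m - limn u| < e.
  by move/cvgrPdist_lt : cu => /(_ e e0); apply: filterS => m; rewrite distrC.
rewrite -(subrKA (u (n + m)%N)); apply: le_trans (ler_normD _ _) _.
by apply: lerD => //; apply/ltW/um; rewrite /= leq_addl.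
Qed.

End vector_calculus.

(** * Differential equations with a globally Lipschitz field *)

Lemma half_expn_cvg (R : realType) (c : R) : (fun n => c * 2^-1 ^+ n) @ \oo --> (0 : R).
Proof.
rewrite -(mulr0 c); apply: cvgMr; apply: cvg_expr.
by rewrite ger0_norm ?invr_ge0// invf_lt1 ?ltr1n.
Qed.

Lemma half_expn_small (R : realType) (c e : R) : 0 < e ->
  exists n, c * 2^-1 ^+ n <= e.
Proof.
move=> e0; have /cvgrPdist_lt/(_ e e0)[n _ Hn] := @half_expn_cvg R c.
exists n; have := Hn n (leqnn n); rewrite sub0r normrN => /ltW.
exact: le_trans (ler_norm _).
Qed.

Lemma locally_uniform_limit_continuous (R : realType) (S : topologicalType)
    (W : normedModType R) (f : S -> W) (x : S) :
  (forall e : R, 0 < e -> exists g : S -> W, {for x, continuous g} /\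
    \forall y \near x, `|f y - g y| <= e) -> {for x, continuous f}.
Proof.
move=> fg; apply/cvgrPdist_le => e e0.
have e3 : 0 < e / 3 by rewrite divr_gt0.
have [g [/cvgrPdist_le/(_ _ e3) cg fge]] := fg _ e3.
have fx := nbhs_singleton fge.
near=> y.
have gy : `|g x - g y| <= e / 3 by near: y.
have fy : `|f y - g y| <= e / 3 by near: y.
rewrite -(subrKA (g x)) -(subrKA (g y) (g x)).
have -> : e = e / 3 + (e / 3 + e / 3) by field.
apply: le_trans (ler_normD _ _) (lerD _ _) => //.
by apply: le_trans (ler_normD _ _) (lerD _ _) => //; rewrite distrC.
Unshelve. all: by end_near. Qed.

Section ode.
Context {R : realType} {N : nat}.

Lemma bounded_on_segment (g : R -> 'rV[R]_N) (T : R) : continuous g ->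
  exists2 B : R, 0 <= B & forall t : R, `|t| <= T -> `|g t| <= B.
Proof.
move=> cg; have [T0|T0] := leP 0 T; last first.
  by exists 0 => // t tT; have := le_lt_trans tT T0; rewrite normr_lt0.
have cn : {within `[- T, T], continuous (fun t => `|g t|)}.
  apply: continuous_subspaceT => t; apply: continuous_comp; first exact: cg.
  exact: norm_continuous.
have [|c _ Hc] := EVT_max _ cn; first by rewrite (le_trans _ T0)// oppr_le0.
exists `|g c| => // t; rewrite ler_norml => tT.
by apply: Hc; rewrite in_itv.
Qed.

(** The comparison function solves [p' = l * p]. Bounds weighted by [expR (l * |t|)] let Picard
    iteration and Gronwall's inequality work on a segment of any length, without gluing short
    intervals. *)
Lemma derive_exp_bound (w w' : R -> 'rV[R]_N) (l C T : R) :
  (forall t : R, is_derive t 1 w (w' t)) ->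
  (forall t : R, `|t| <= T -> `|w' t| <= l * (C * expR (l * `|t|))) ->
  `|w 0| <= C -> forall t : R, `|t| <= T -> `|w t| <= C * expR (l * `|t|).
Proof.
move=> dw w'le w0.
apply: (derive_norm_le (p := fun t => C * expR (l * t))
  (p' := fun t => l * (C * expR (l * t))) dw) => //; last first.
  by rewrite mulr0 expR0 mulr1.
move=> t; rewrite mulrCA.
have dl : is_derive t 1 (fun t : R => l * t) l.
  by rewrite -[X in is_derive _ _ _ X]mulr1; exact: is_deriveZ.
have := is_derive1_comp (f := expR) (g := fun t : R => l * t) (is_derive_expR _) dl.
rewrite mulrC => de; exact: is_deriveZ.
Qed.

(* Bootstrapping: a bound A for w on the segment improves, by
   derive_exp_bound, to (eps + A / 2 ^ n) expR ((2 k + 1) |t|) for every n. *)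
Lemma gronwall_bound (w w' : R -> 'rV[R]_N) (k eps T : R) : 0 <= k -> 0 <= eps ->
  (forall t : R, is_derive t 1 w (w' t)) -> w 0 = 0 ->
  (forall t : R, `|t| <= T -> `|w' t| <= k * (`|w t| + eps)) ->
  forall t : R, `|t| <= T -> `|w t| <= eps * expR ((2 * k + 1) * `|t|).
Proof.
move=> k0 eps0 dw w0 w'le; set l := 2 * k + 1.
have l0 : 0 <= l by rewrite addr_ge0// mulr_ge0.
have e1 (t : R) : 1 <= expR (l * `|t|) by rewrite -expR0 ler_expR mulr_ge0.
have [A A0 wA] := bounded_on_segment T (is_derive_continuous dw).
have boot n (t : R) : `|t| <= T ->
    `|w t| <= (eps + A * 2^-1 ^+ n) * expR (l * `|t|).
  elim: n t => [|n IH] t tT.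
    rewrite expr0 mulr1; apply: le_trans (wA t tT) _.
    by apply: (@le_trans _ _ (eps + A)); rewrite ?lerDr// ler_peMr// addr_ge0.
  apply: (derive_exp_bound dw _ _ tT); last first.
    by rewrite w0 normr0 addr_ge0// mulr_ge0// exprn_ge0.
  move=> s sT; apply: le_trans (w'le s sT) _.
  have := IH s sT; have := e1 s; have : 0 <= A * 2^-1 ^+ n.
    by rewrite mulr_ge0// exprn_ge0.
  rewrite exprS (mulrCA A) /l.
  move: (A * _) (expR _) `|w s| => a e v a0 e1' ve.
  (* Halving [a] is paid by [k * a = 2 * k * (a / 2)]; the second [k * eps] is absorbed because
     [e >= 1]. *)
  have kv := ler_wpM2l k0 ve.
  have ke : k * eps <= k * eps * e by rewrite ler_peMr// mulr_ge0.
  have : 0 <= (eps + 2^-1 * a) * e.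
    by rewrite mulr_ge0 ?(le_trans _ e1')// addr_ge0// mulr_ge0// invr_ge0.
  lra.
move=> t tT; apply/ler_addgt0Pr => e e0.
have [n nle] := half_expn_small (A * expR (l * `|t|)) e0.
apply: le_trans (boot n t tT) _.
by rewrite mulrDl lerD2l mulrAC.
Qed.

Variables (G : R -> 'rV[R]_N -> 'rV[R]_N) (k : R).
Hypothesis k0 : 0 <= k.
Hypothesis Glip : forall t x y, `|G t x - G t y| <= k * `|x - y|.
Hypothesis Gcont : forall x, continuous (G^~ x).

Lemma field_continuous (x : R -> 'rV[R]_N) :
  continuous x -> continuous (fun t => G t (x t)).
Proof.
move=> cx t; apply/cvgrPdist_le => e e0.
have e2 : 0 < e / 2 by rewrite divr_gt0.
have ek : 0 < e / 2 / (k + 1) by rewrite divr_gt0// ltr_wpDl.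
have /cvgrPdist_le/(_ _ e2) cG := @Gcont (x t) t.
have /cvgrPdist_le/(_ _ ek) cxt := cx t.
near=> s.
rewrite -(subrKA (G s (x t))) [e]splitr.
apply: le_trans (ler_normD _ _) (lerD _ _); first by near: s.
apply: le_trans (Glip _ _ _) _.
have : `|x t - x s| <= e / 2 / (k + 1) by near: s.
rewrite ler_pdivlMr ?ltr_wpDl//; apply: le_trans.
by rewrite mulrC ler_wpM2l// lerDl.
Unshelve. all: by end_near. Qed.

(** Picard iteration from the constant [r]: in the norm weighted by [expR (l * |t|)] each step
    halves the distance between iterates, so they converge locally uniformly on the whole line. *)
Lemma ode_exists (r : 'rV[R]_N) : exists x : R -> 'rV[R]_N,
  x 0 = r /\ forall t : R, is_derive t 1 x (G t (x t)).
Proof.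
(* The guard [continuous x] makes the step total, so that [choice] turns it into an operator [P];
   every iterate is continuous by induction. *)
have step (x : R -> 'rV[R]_N) : exists y : R -> 'rV[R]_N, continuous x ->
    y 0 = r /\ forall t : R, is_derive t 1 y (G t (x t)).
  have [cx|ncx] := pselect (continuous x); last by exists x.
  have [H H0 dH] := continuous_primitive_row (field_continuous cx).
  exists (fun t => r + H t) => _; split; first by rewrite H0 addr0.
  move=> t; rewrite -[G t _]add0r; exact: is_deriveD.
have [P PP] := choice step.
pose x n := iter n P (cst r).
have xc n : continuous (x n).
  elim: n => [|n IH]; first by move=> t; exact: cvg_cst.
  exact: is_derive_continuous (PP _ IH).2.
have x0 n : x n 0 = r by case: n => [//|n]; exact: (PP _ (xc n)).1.
have dx n (t : R) : is_derive t 1 (x n.+1) (G t (x n t)) := (PP _ (xc n)).2 t.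
(* The summand [2 * k] yields the factor 1/2 per iteration; the summand [1] absorbs the bound [B] of
   the field at [r], even for [k = 0]. *)
set l := 2 * k + 1.
have l0 : 0 <= l by rewrite addr_ge0// mulr_ge0.
have e1 (t : R) : 1 <= expR (l * `|t|) by rewrite -expR0 ler_expR mulr_ge0.
have rate (T : R) : exists2 B : R, 0 <= B & forall n p (t : R), `|t| <= T ->
    `|x n t - x (n + p)%N t| <= B * expR (l * `|t|) * 2^-1 ^+ n.
  have [B B0 GB] := bounded_on_segment T (@Gcont r).
  exists B => // n p; elim: n => [|n IH] t tT.
    (* For [n = 0] all iterates must stay at a bounded weighted distance from [r]; this is a
       separate induction on [p]. *)
    rewrite add0n expr0 mulr1 /= distrC; case: p => [|p].
      by rewrite subrr normr0 mulr_ge0// expR_ge0.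
    elim: p t tT => [|p IH] t tT.
      apply: (derive_exp_bound (w := fun t => x 1%N t - r)
        (w' := fun t => G t r - 0) _ _ _ tT).
      - move=> s /GB sB; rewrite subr0; apply: le_trans sB _.
        rewrite /l; have := e1 s; move: (expR _) => e e1'.
        have Be : B <= B * e by rewrite ler_peMr.
        have : 0 <= k * (B * e) by rewrite mulr_ge0// (le_trans B0).
        lra.
      - by rewrite x0 subrr normr0.
    apply: (derive_exp_bound (w := fun t => x p.+2 t - r)
        (w' := fun t => G t (x p.+1 t) - 0) _ _ _ tT).
    - move=> s sT; rewrite subr0 -[X in `|X|](subrK (G s r)).
      apply: le_trans (ler_normD _ _) _.
      have := GB s sT; have := Glip s (x p.+1 s) r; have := IH s sT; have := e1 s.
      rewrite /l; move: (expR _) `|x _ _ - _| `|_ - G s r| `|G s r| => e a b c.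
      move=> e1' ae bka cB; have ka := ler_wpM2l k0 ae.
      have Be : B <= B * e by rewrite ler_peMr.
      have : 0 <= k * (B * e) by rewrite mulr_ge0// (le_trans B0).
      lra.
    - by rewrite x0 subrr normr0.
  rewrite mulrAC; apply: (derive_exp_bound (w := fun t => x n.+1 t - x (n.+1 + p)%N t)
    (w' := fun t => G t (x n t) - G t (x (n + p)%N t)) _ _ _ tT).
  - move=> s sT; apply: le_trans (Glip _ _ _) _.
    have := IH s sT; have := e1 s; have : 0 <= B * 2^-1 ^+ n.
      by rewrite mulr_ge0// exprn_ge0.
    rewrite exprS (mulrCA B) /l [B * _ * _]mulrAC.
    move: (B * _) (expR _) `|x n s - _| => b e a b0 e1' ae.
    have ka := ler_wpM2l k0 ae.
    have : 0 <= 2^-1 * b * e by rewrite !mulr_ge0 ?(le_trans _ e1')// invr_ge0.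
    lra.
  - by rewrite !x0 subrr normr0 mulr_ge0// exprn_ge0.
pose z t := limn (x^~ t).
(* Two consecutive iterates are controlled at once: [x n.+1] approximates [z], and its derivative is
   the field along [x n]. *)
have unif (T e : R) : 0 < e -> exists n, forall (t : R), `|t| <= T ->
    `|x n t - z t| <= e /\ `|x n.+1 t - z t| <= e.
  move=> e0; have [B B0 xB] := rate T.
  have [n nle] := half_expn_small (B * expR (l * T)) e0.
  exists n => t tT.
  have xz m : `|x m t - z t| <= B * expR (l * T) * 2^-1 ^+ m.
    apply: (cauchy_rate_cvg (u := x^~ t) (b := fun m => _ * 2^-1 ^+ m) _ _).2.
      move=> i j; apply: le_trans (xB _ _ _ tT) _.
      rewrite ler_wpM2r ?exprn_ge0// ler_wpM2l// ler_expR ler_wpM2l//.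
    exact: half_expn_cvg.
  split; first exact: le_trans nle.
  apply: le_trans (xz _) (le_trans _ nle).
  by rewrite ler_wpM2l ?mulr_ge0 ?expR_ge0// exprS ler_piMl ?exprn_ge0// invf_le1 ?ler1n.
have zc : continuous z.
  move=> t; apply: locally_uniform_limit_continuous => e e0.
  have [n Hn] := unif (`|t| + 1) e e0.
  exists (x n); split; first exact: xc.
  have /cvgrPdist_le/(_ 1 ltr01) : s @[s --> t] --> t by exact: cvg_id.
  apply: filterS => s st; rewrite distrC; apply: (Hn s _).1.
  by rewrite -(subrK t s); apply: le_trans (ler_normD _ _) _; rewrite distrC addrC lerD2l.
exists z; split.
  by rewrite /z (_ : x^~ 0 = cst r) ?lim_cst//; apply/funext => n /=; exact: x0.
apply: is_derive_locally_uniform_limit (field_continuous zc) _ => T e e0.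
(* Dividing by [k + 1] serves both demands: [k + 1 >= 1] for the functions, [k + 1 >= k] for the
   fields. *)
have e'0 : 0 < e / (k + 1) by rewrite divr_gt0// ltr_wpDl.
have [n Hn] := unif T _ e'0.
exists (x n.+1), (fun t => G t (x n t)); split=> [t|t /Hn[xn xn1]]; first exact: dx.
have k1 : 0 < k + 1 by rewrite ltr_wpDl.
move: xn xn1; rewrite !ler_pdivlMr// => xn xn1; split.
  by apply: le_trans xn1; rewrite ler_peMr// lerDr.
apply: le_trans (Glip _ _ _) (le_trans _ xn).
by rewrite mulrC ler_wpM2l// lerDl.
Qed.

End ode.

(** * Joint continuity of the evolution operators *)

(** A small closed ball in a chart is compact, so its image under [chart_inv] is compact, hence
    closed in the Hausdorff space [M]. The Baire argument needs this regularity of its target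
    space. *)
Lemma smooth_manifold_regular (R : realType) (q : nat) (M : topologicalType)
    (atlas : set (chart R M q)) : smooth_manifold atlas -> regular_space M.
Proof.
move=> hM m U mU.
have [c _ cm] := atlas_cover hM m.
have img_m : (c @` chart_dom c) (c m) by exists m.
have nU : nbhs (c m) ((chart_inv c @^-1` U) `&` (c @` chart_dom c)).
  apply: filterI; last by apply: open_nbhs_nbhs; split=> //; exact: chart_img_open.
  by apply: chart_inv_continuous img_m _ _; rewrite chart_mapK.
have /nbhs_closedballP[r rU] := nU.
pose K := closed_ball (c m) r%:num.
have cK : compact K.
  apply: bounded_closed_compact; last exact: closed_ball_closed.
  exists (`|c m| + r%:num); split; first exact: num_real.
  move=> b cb v; rewrite /K closed_ballE// /closed_ball_ /= => vr.
  rewrite -(subrK (c m) v); apply: le_trans (ler_normD _ _) _.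
  by rewrite addrC; apply: le_trans (ltW cb); rewrite lerD2l distrC.
have clK : closed (chart_inv c @` K).
  apply: compact_closed; first exact: manifold_hausdorff hM.
  apply: continuous_compact => //; apply: continuous_in_subspaceT => v.
  by rewrite inE => /rU[_ ?]; exact: chart_inv_continuous.
exists (chart_inv c @` K); last first.
  by rewrite -((closure_id _).1 clK) => _ [v /rU[vU _] <-].
have nB : nbhs m (chart_dom c `&` c @^-1` ball (c m) r%:num).
  apply: filterI; first by apply: open_nbhs_nbhs; split=> //; exact: chart_dom_open.
  by apply: (chart_map_continuous cm); exact: nbhsx_ballx.
apply: filterS nB => p [cp /subset_closed_ball Kp].
by exists (c p) => //; rewrite chart_mapK.
Qed.

(** This is the complement of the frontier of [A], and the frontier of a closed set has empty
    interior. *)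
Lemma frontier_free_dense (T : topologicalType) (A : set T) : closed A ->
  open (~` A `|` A^°) /\ dense (~` A `|` A^°).
Proof.
move=> cA; split.
  by apply: openU; [exact: closed_openC | exact: open_interior].
move=> D [x Dx] oD; apply: contrapT => DO.
have DA : D `<=` A.
  by move=> y Dy; apply: contrapT => nAy; apply: DO; exists y; split=> //; left.
apply: DO; exists x; split=> //; right.
by move: DA; rewrite open_subsetE//; exact.
Qed.

(* Outside the frontiers of the countably many closed sets
   {s | forall p in W, h s p \in closure P}, with P and W basic open sets,
   separate continuity improves to joint continuity. *)
Lemma separately_continuous_point (R : realType) (M M' : topologicalType)
    (h : R -> M -> M') (m : M) :
  @second_countable M -> @second_countable M' -> regular_space M' ->
  (forall p, continuous (h^~ p)) -> (forall s, {for m, continuous (h s)}) ->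
  exists s : R, h x.1 x.2 @[x --> (s, m)] --> h s m.
Proof.
move=> [BM cBM [oBM bM]] [BM' cBM' [oBM' bM']] reg ch1 ch2.
pose A P W := [set s | forall p, W p -> closure P (h s p)].
have clA P W : closed (A P W).
  rewrite (_ : A P W = \bigcap_(p in W) (h^~ p @^-1` closure P)); last first.
    by apply/seteqP; split.
  apply: closed_bigI => p _; apply: preimage_closed; last exact: closed_closure.
  by move=> s _; exact: ch1.
have enum (T : topologicalType) (B : set (set T)) : countable B ->
    exists e : nat -> set T, forall P, B P -> exists n, e n = P.
  move=> /pfcard_geP[->|[e]]; first by exists (fun=> set0).
  by exists e => P /(@surj _ _ _ _ e)[n _ <-]; exists n.
have [e eP] := enum _ _ cBM'; have [f fP] := enum _ _ cBM.
(* Pairs of basic sets are coded by [pickle]; an index that codes no pair contributes the whole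
   line, which leaves the intersection unchanged. *)
pose O i := if unpickle i is Some (a, b) then ~` A (e a) (f b) `|` (A (e a) (f b))^°
  else setT.
have [|s [_ Os]] := @Baire R R^o O _ setT (ex_intro _ 0 I) openT.
  move=> i; rewrite /O; case: (unpickle i) => [[a b]|].
    exact: frontier_free_dense.
  split; first exact: openT.
  by move=> D [x Dx] _; exists x.
exists s => U /reg[V nV VU].
have [P [BP Ps] PV] := bM' _ _ nV.
have nW : nbhs m (h s @^-1` P).
  by apply: ch2; apply: open_nbhs_nbhs; split=> //; exact: oBM'.
have [W [BW Wm] WP] := bM _ _ nW.
have [[a ea] [b fb]] := (eP _ BP, fP _ BW).
(* [s] lies in [A P W] because [h s] maps [W] into [P]; being off the frontier, it is an interior
   point, so nearby times map [W] into [closure P]. *)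
have := Os (pickle (a, b)) I; rewrite /O pickleK ea fb => -[nA|sA].
  by case: nA => p /WP hp; exact: subset_closure.
exists ((A P W), W) => /=.
  by split; [exact: sA | apply: open_nbhs_nbhs; split=> //; exact: oBM].
move=> [s' p] [/= As' Wp]; apply: VU; exact: (closure_subset PV (As' p Wp)).
Qed.

Lemma evolution_jointly_continuous (R : realType) (q : nat) (M : topologicalType)
    (atlas : set (chart R M q)) (X : chart R M q -> M -> 'rV[R]_q)
    (phi : R -> M -> M) :
  smooth_manifold atlas -> evolution_operators atlas X phi ->
  forall s m, phi x.1 x.2 @[x --> (s, m)] --> phi s m.
Proof.
move=> hM hphi s m.
have cphi t : continuous (phi t) by have [? [_ _ []]] := evolution_diffeo hphi t.
have [s1 cs1] := separately_continuous_point (manifold_second_countable hM)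
  (manifold_second_countable hM) (smooth_manifold_regular hM)
  (evolution_continuous hphi) (fun t => cphi t m).
(* At [t = s] the inner time is [s1]; the outer map has a fixed time, so its continuity in the phase
   point suffices. *)
have E t p : phi t p = phi (s - s1) (phi (t - (s - s1)) p).
  by rewrite -[RHS]/((phi _ \o phi _) p) -(evolutionD hphi) addrC subrK.
under eq_fun do rewrite E; rewrite E.
apply: (@cvg_comp _ _ _ (fun x : R * M => phi (x.1 - (s - s1)) x.2)
  (phi (s - s1)) _ _ _ _ (cphi (s - s1) (phi (s - (s - s1)) m))).
have -> : s - (s - s1) = s1 by ring.
apply: (@cvg_comp _ _ _ (fun x : R * M => (x.1 - (s - s1), x.2))
  (fun x => phi x.1 x.2) _ _ _ _ cs1).
have c1 : x.1 - (s - s1) @[x --> (s, m)] --> s1.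
  rewrite -[X in _ --> X](_ : s - (s - s1) = s1); last by ring.
  by apply: cvgB; [exact: cvg_fst|exact: cvg_cst].
exact: cvg_pair c1 cvg_snd.
Qed.

(** Joint continuity gives a product neighbourhood around each [(s, m)]; compactness of [[- T, T]]
    makes the neighbourhood of [m] common to all times. *)
Lemma tube_uniform (R : realType) (M : topologicalType) (W : normedModType R)
    (g : R -> M -> W) (m : M) (T e : R) :
  (forall s, g x.1 x.2 @[x --> (s, m)] --> g s m) -> 0 < e ->
  \forall p \near m, forall s, `|s| <= T -> `|g s m - g s p| <= e.
Proof.
move=> cg e0.
have := @segment_compact R (- T) T.
move=> /compact_near_coveringP/(_ M (nbhs m)
  (fun p s => `|g s m - g s p| <= e) _) H.
have {}H : \forall p \near m, `[- T, T] `<=` (fun s => `|g s m - g s p| <= e).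
  apply: H => s _.
  have /cvgrPdist_le/(_ (e / 2)) := cg s.
  rewrite divr_gt0// => /(_ isT)[[S Q] /= [nS nQ] SQ].
  exists (S, Q) => // -[s' p] [/= Ss' Qp].
  rewrite -(subrKA (g s m)) [e]splitr; apply: le_trans (ler_normD _ _) (lerD _ _).
    by rewrite distrC; apply: (SQ (s', m)); split=> //=; exact: nbhs_singleton.
  exact: (SQ (s', p)).
by apply: filterS H => p Hp s; rewrite ler_norml => sT; apply: Hp; rewrite /= in_itv.
Qed.

(** * Generalised synchronisation *)

Lemma decay_bound_double (R : realType) (psi : R -> R) :
  decay_bound psi -> decay_bound (fun t => psi t + psi t).
Proof.
move=> [psi0 psic]; split=> [t|]; first by rewrite addr_gt0.
by rewrite -[X in _ --> X](addr0 (0 : R)); exact: cvgD.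
Qed.

Lemma decay_bound_small (R : realType) (psi : R -> R) (e : R) :
  decay_bound psi -> 0 < e ->
  exists2 A : R, 0 <= A & forall t, A < t -> psi t <= e.
Proof.
move=> [_ /cvgrPdist_le psic] e0; have [A [_ HA]] := psic e e0.
exists `|A| => // t At; have := HA t (le_lt_trans (ler_norm A) At).
by rewrite sub0r normrN; exact: le_trans (ler_norm _).
Qed.

Section reservoir.
Context {R : realType} {M : topologicalType} {d N : nat}.
Variables (phi : R -> M -> M) (omega : M -> 'rV[R]_d).
Variables (F : 'rV[R]_N * 'rV[R]_d -> 'rV[R]_N) (k : R).
Hypothesis phi0 : phi 0 = id.
Hypothesis phiD : forall s t, phi (s + t) = phi s \o phi t.
Hypothesis phi_joint : forall s m, phi x.1 x.2 @[x --> (s, m)] --> phi s m.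
Hypothesis omegac : continuous omega.
Hypothesis k0 : 0 <= k.
Hypothesis Flip : forall a b, `|F a - F b| <= k * `|a - b|.

Lemma flow_continuous t : continuous (phi t).
Proof.
move=> m; apply: (@cvg_comp _ _ _ (fun p => (t, p)) (fun x => phi x.1 x.2)
  _ _ _ _ (phi_joint (s := t) (m := m))).
have ct : t @[_ --> m] --> t by exact: cvg_cst.
exact: cvg_pair ct cvg_id.
Qed.

Lemma orbit_continuous m : continuous (phi^~ m).
Proof.
move=> t; apply: (@cvg_comp _ _ _ (fun s => (s, m)) (fun x => phi x.1 x.2)
  _ _ _ _ (phi_joint (s := t) (m := m))).
have cm : m @[_ --> t] --> m by exact: cvg_cst.
exact: cvg_pair cvg_id cm.
Qed.

Lemma flowNK t m : phi t (phi (- t) m) = m.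
Proof. by rewrite -[LHS]/((phi t \o phi (- t)) m) -phiD subrr phi0. Qed.

Lemma flowKN t m : phi (- t) (phi t m) = m.
Proof. by have := flowNK (- t) m; rewrite opprK. Qed.

Lemma field_lip u x y : `|F (x, u) - F (y, u)| <= k * `|x - y|.
Proof.
apply: le_trans (Flip _ _) _.
by rewrite prod_normE /= subrr normr0 (max_idPl _).
Qed.

Lemma field_cont m x : continuous (fun t => F (x, omega (phi t m))).
Proof.
have Fc : continuous F.
  move=> a; apply/cvgrPdist_le => e e0.
  have ek : 0 < e / (k + 1) by rewrite divr_gt0// ltr_wpDl.
  have /cvgrPdist_le/(_ _ ek) : b @[b --> a] --> a by exact: cvg_id.
  apply: filterS => b; rewrite ler_pdivlMr ?ltr_wpDl// => ab.
  apply: le_trans (Flip _ _) (le_trans _ ab).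
  by rewrite mulrC ler_wpM2l// lerDl.
move=> t; apply: (@cvg_comp _ _ _ (fun s => (x, omega (phi s m))) F _ _ _ _ (Fc _)).
have cx : x @[_ --> t] --> x by exact: cvg_cst.
have cw : omega (phi s m) @[s --> t] --> omega (phi t m).
  by apply: (@cvg_comp _ _ _ (phi^~ m) omega); [exact: orbit_continuous | exact: omegac].
exact: cvg_pair cx cw.
Qed.

Lemma reservoir_solution_exists m r : exists x, reservoir_solution phi omega F m r x.
Proof.
exact: (ode_exists (G := fun t x => F (x, omega (phi t m))) k0
  (fun t => field_lip (omega (phi t m))) (@field_cont m) r).
Qed.

Lemma reservoir_solution_shift s m r x : reservoir_solution phi omega F m r x ->
  reservoir_solution phi omega F (phi s m) (x s) (fun t => x (t + s)).
Proof.
move=> [_ dx]; split=> [|t]; first by rewrite add0r.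
apply: is_derive_translate.
by rewrite -[phi t (phi s m)]/((phi t \o phi s) m) -phiD; exact: dx.
Qed.

(** By [tube_uniform] the inputs driving two nearby solutions differ little up to time [|T|].
    Gronwall's inequality amplifies this by at most [E], hence the tolerance [e / E]. *)
Lemma reservoir_solution_continuous (sol : M -> R -> 'rV[R]_N) r T :
  (forall m, reservoir_solution phi omega F m r (sol m)) -> continuous (sol^~ T).
Proof.
move=> solP m; apply/cvgrPdist_le => e e0.
set E := expR ((2 * k + 1) * `|T|).
have e'0 : 0 < e / E by rewrite divr_gt0// expR_gt0.
have gc s : omega (phi x.1 x.2) @[x --> (s, m)] --> omega (phi s m).
  apply: (@cvg_comp _ _ _ (fun x => phi x.1 x.2) omega).
    exact: phi_joint.
  exact: omegac.
have := tube_uniform (g := fun s p => omega (phi s p)) `|T| gc e'0.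
apply: filterS => p Hp.
rewrite -[leRHS](divfK (lt0r_neq0 (expR_gt0 ((2 * k + 1) * `|T|)))).
apply: (@gronwall_bound _ _ (fun t => sol m t - sol p t)
  (fun t => F (sol m t, omega (phi t m)) - F (sol p t, omega (phi t p)))
  k (e / E) `|T| k0 (ltW e'0)) => //.
- by move=> t; have [_ ?] := solP m; have [_ ?] := solP p; exact: is_deriveB.
- by rewrite (solP m).1 (solP p).1 subrr.
- move=> t tT; apply: le_trans (Flip _ _) _; rewrite ler_wpM2l//.
  (* The product norm is a maximum, bounded here by the sum that [gronwall_bound] expects. *)
  rewrite prod_normE /= ge_max lerDl (ltW e'0) /=.
  by rewrite (le_trans (Hp t tT))// lerDr.
Qed.

Lemma synchronisation_stable V f :
  uniform_generalised_synchronisation phi omega F V f ->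
  uniformly_asymptotically_stable phi omega F V.
Proof.
move=> [_ [psi dpsi fpsi]]; exists (fun t => psi t + psi t).
  exact: decay_bound_double.
move=> m x0 y0 x y Vx Vy xP yP t t0.
rewrite -(subrKA (f (phi t m))); apply: le_trans (ler_normD _ _) (lerD _ _).
  by rewrite distrC; exact: fpsi Vx xP t t0.
exact: fpsi Vy yP t t0.
Qed.

(** A point of [V] serves as common initial point [r]. Forward invariance keeps an earlier started
    solution in [V], so that stability can compare it with a fresh one from [r]. *)
Lemma stable_synchronisation V : V !=set0 -> forward_invariant phi omega F V ->
  uniformly_asymptotically_stable phi omega F V ->
  exists f, uniform_generalised_synchronisation phi omega F V f.
Proof.
move=> [r Vr] inv [psi dpsi stab].
have [sol solP] := choice (fun m => reservoir_solution_exists m r).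
pose ft t m := sol (phi (- t) m) t.
have ft_cauchy m s t : 0 <= s -> 0 <= t -> `|ft s m - ft (s + t) m| <= psi s.
  (* [m'] is the phase at time [-(s + t)]; after time [t] its orbit reaches [phi (- s) m], where the
     fresh solution starts. *)
  move=> s0 t0; set m' := phi (- (s + t)) m.
  have mE : phi (- s) m = phi t m'.
    by rewrite -[RHS]/((phi t \o phi _) m) -phiD opprD addrCA subrr addr0.
  have yP := reservoir_solution_shift t (solP m').
  rewrite /ft mE; apply: (stab _ _ _ _ _ Vr _ (solP _) yP s s0).
  exact: inv Vr (solP m') t t0.
have psin : psi n%:R @[n --> \oo] --> 0.
  by apply: (@cvg_comp _ _ _ (fun n : nat => n%:R) psi _ _ _ _ dpsi.2); exact: cvgr_idn.
pose f m := limn (fun n : nat => ft n%:R m).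
have fn m n : `|ft n%:R m - f m| <= psi n%:R.
  apply: (cauchy_rate_cvg _ psin).2 => i j.
  by rewrite natrD; exact: ft_cauchy.
(* [f] is a limit along integers only; an integer [n] past [t + A] carries the rate over to every
   real [t >= 0]. *)
have f_t m t : 0 <= t -> `|ft t m - f m| <= psi t.
  move=> t0; apply/ler_addgt0Pr => e e0.
  have [A A0 HA] := decay_bound_small dpsi e0.
  pose n := Num.bound (t + A).
  have An : t + A < n%:R.
    by apply: le_lt_trans (archi_boundP (addr_ge0 t0 A0)).
  rewrite -(subrKA (ft n%:R m)); apply: le_trans (ler_normD _ _) (lerD _ _).
    rewrite -(subrKC t n%:R); apply: ft_cauchy => //; lra.
  by apply: le_trans (fn m n) (HA _ _); lra.
exists f; split.
  move=> m; apply: locally_uniform_limit_continuous => e e0.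
  have [A A0 HA] := decay_bound_small dpsi e0.
  (* The [+ 1] is there because the decay estimate holds strictly beyond [A]. *)
  exists (ft (A + 1)); split.
    apply: (@continuous_comp _ _ _ (phi (- (A + 1))) (sol^~ (A + 1))).
      exact: flow_continuous.
    exact: reservoir_solution_continuous solP _.
  apply: nearW => p; rewrite distrC; apply: le_trans (f_t _ _ _) (HA _ _); lra.
exists (fun t => psi t + psi t); first exact: decay_bound_double.
move=> m r' x Vr' xP t t0.
(* [ft t (phi t m)] is [sol m t], which is driven by the same orbit as [x]. *)
rewrite -(subrKA (ft t (phi t m))); apply: le_trans (ler_normD _ _) (lerD _ _).
  by rewrite distrC; exact: f_t.
by rewrite /ft flowKN; exact: stab Vr Vr' (solP m) xP t t0.
Qed.

Lemma synchronisation_is_derive V f m : V !=set0 ->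
  uniform_generalised_synchronisation phi omega F V f ->
  forall t : R, is_derive t 1 (fun t => f (phi t m)) (F (f (phi t m), omega (phi t m))).
Proof.
move=> [r Vr] [fc [psi dpsi fpsi]].
have zc : continuous (fun t => f (phi t m)).
  by move=> t; apply: (@continuous_comp _ _ _ (phi^~ m) f);
    [exact: orbit_continuous | exact: fc].
apply: (is_derive_locally_uniform_limit (field_continuous
  (G := fun t x => F (x, omega (phi t m))) k0
  (fun t => field_lip (omega (phi t m))) (@field_cont m) zc)) => T e e0.
have k1 : 0 < k + 1 by rewrite ltr_wpDl.
have [A A0 HA] := decay_bound_small dpsi (divr_gt0 e0 k1).
(* A start at time [-S] leaves an elapsed time [t + S > A] whenever [|t| <= T], so the solution is
   already close to [f] there. *)
pose S := A + `|T| + 1.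
have [x xP] := reservoir_solution_exists (phi (- S) m) r.
have := reservoir_solution_shift S xP; rewrite flowNK => -[_ dy].
exists (fun t => x (t + S)), (fun t => F (x (t + S), omega (phi t m))).
split=> // t tT.
have tS : A < t + S.
  by have := ler_norm T; move: tT; rewrite /S ler_norml => /andP[]; lra.
have : `|x (t + S) - f (phi t m)| <= e / (k + 1).
  rewrite distrC -[X in phi t X](flowNK S) -[phi t (phi S _)]/((phi t \o phi S) _) -phiD.
  by apply: le_trans (fpsi _ _ _ Vr xP _ _) (HA _ tS); lra.
rewrite ler_pdivlMr// => xf; split.
  by apply: le_trans xf; rewrite ler_peMr// lerDr.
apply: le_trans (field_lip _ _ _) (le_trans _ xf).
by rewrite mulrC ler_wpM2l// lerDl.
Qed.

End reservoir.

(** Stability controls only solutions that start in [V]; forward invariance lets it apply again at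
    later times. For empty [V] every continuous [f] is vacuously a synchronisation, so the PDE asks
    for a point of [V]. *)
Theorem theorem2p8 (R : realType) (q : nat) (M : topologicalType)
    (atlas : set (chart R M q)) (hM : smooth_manifold atlas)
    (X : chart R M q -> M -> 'rV[R]_q) (hX : smooth_vector_field atlas X)
    (phi : R -> M -> M) (hphi : evolution_operators atlas X phi)
    (d N : nat) (omega : M -> 'rV[R]_d) (homega : continuous omega)
    (F : 'rV[R]_N * 'rV[R]_d -> 'rV[R]_N)
    (hF : Ck_on 1 setT F) (hFlip : exists k : R, k.-lipschitz F)
    (V : set 'rV[R]_N) :
  [/\ (exists f, uniform_generalised_synchronisation phi omega F V f) ->
        uniformly_asymptotically_stable phi omega F V,
      forward_invariant phi omega F V ->
        uniformly_asymptotically_stable phi omega F V ->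
        exists f, uniform_generalised_synchronisation phi omega F V f
    & V !=set0 ->
        forall f, uniform_generalised_synchronisation phi omega F V f ->
        forall m, lie_derivable phi f m /\
          lie_derivative phi f m = F (f m, omega m)].
Proof.
have [k0 klip] := hFlip.
have Flip a b : `|F a - F b| <= `|k0| * `|a - b|.
  apply: le_trans (klip (a, b) _) _ => //.
  by rewrite ler_wpM2r// ler_norm.
have phi0 := evolution0 hphi; have phiD := evolutionD hphi.
have phic := evolution_jointly_continuous hM hphi.
split.
- by move=> [f]; exact: synchronisation_stable.
- have [[r Vr]|V0] := pselect (V !=set0).
    by apply: (stable_synchronisation phi0 phiD phic homega (normr_ge0 k0) Flip); exists r.
  (* With [V] empty the constant [0] shadows all solutions vacuously. *)
  move=> _ [psi dpsi _]; exists (fun=> 0); split; first by move=> m; exact: cvg_cst.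
  by exists psi => // m r x Vr; case: V0; exists r.
- move=> V0 f fP m.
  have := synchronisation_is_derive phi0 phiD phic homega (normr_ge0 k0) Flip m V0 fP 0.
  by rewrite phi0 => -[dz zE]; split.
Qed.
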